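(* Consider the coupled micro-grid system $$\tau_{v,i}\dot V_i=\Bigl(V^*-V_i-k_i\sum_{j\in\mathcal{N}}G_{ij}V_iV_j+k_iP_i^{\mathrm{set}}\Bigr)\Bigl(1-\frac{(V_i-V^* )^2}{\Delta V^2}\Bigr),\qquad i\in\mathcal{N},$$ $$\tau_b\dot P_b^{\mathrm{set}}=P_b^d-P_b^{\mathrm{set}},\qquad b\in\mathcal{B},$$ with constant inputs $P_r^{\mathrm{set}}\in\mathbb{R}$ for $r\in\mathcal{R}$ and $P_b^d\in\mathbb{R}$ for $b\in\mathcal{B}$. Suppose that it has an equilibrium point $\bar x=\{\bar V_b,\bar V_r,\bar P_b^{\mathrm{set}}\}_{b\in\mathcal{B},r\in\mathcal{R}}$ such that $|\bar V_i-V^*|<\Delta V$ for all $i\in\mathcal{N}$. If for all $i\in\mathcal{N}$ $$k_i\,\Delta V\sum_{j\in\mathcal{N}}\frac1{R_{ij}}<\frac12+k_i\frac{V^*}{R_{ii}},$$ then there is a neighbourhood $\mathcal{A}$ of $\bar x$ such that every solution $x=\{V_b,V_r,P_b^{\mathrm{set}}\}_{b\in\mathcal{B},r\in\mathcal{R}}$ with $x(0)\in\mathcal{A}$ satisfies $\lim_{t\to\infty}|x(t)-\bar x|=0$.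
   Context: $\mathcal{N}=\mathcal{R}\cup\mathcal{B}$ is the finite node set of a connected undirected resistive network, partitioned into retailers $\mathcal{R}$ and consumers $\mathcal{B}$. For distinct $i,j$, $A_{ij}=A_{ji}=1/R_{ij}\ge0$ is the conductance of the line between $i$ and $j$ (with $1/R_{ij}=0$ if there is no line), and $R_{ii}>0$ is the impedance (shunt resistance) of node $i$. The network conductance matrix is $G=\mathcal{L}+R^{-1}$ with $R=\mathrm{diag}(\{R_{ii}\}_{i\in\mathcal{N}})$ and $\mathcal{L}=D-A$ the weighted graph Laplacian, $D=\mathrm{diag}(\sum_jA_{ij})$ (with $A_{ii}=0$). Thus $G_{ij}=-1/R_{ij}$ for $i\ne j$ and $G_{ii}=\sum_{j\ne i}1/R_{ij}+1/R_{ii}$. In the stability condition the sum over $j\in\mathcal{N}$ includes the term $j=i$. The constants satisfy $\tau_{v,i}>0$, $k_i>0$, $\tau_b>0$, $\Delta V>0$, and $V^*\in\mathbb{R}$ is the rated voltage.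
   Formalization: The formal theorem additionally assumes that all equilibrium voltages are nonnegative; with voltages of mixed sign (e.g. V*=0, two nodes at -0.99 and 0.99) the stated condition can hold at a saddle, so the claim fails without this. *)

(* Defs.v *)
From HB Require Import structures.
From mathcomp Require Import all_boot all_order all_algebra.
From mathcomp Require Import all_classical all_reals all_analysis.
Set Implicit Arguments.
Unset Strict Implicit.
Unset Printing Implicit Defensive.
Import Order.TTheory GRing.Theory Num.Theory.
Import numFieldNormedType.Exports.
Local Open Scope classical_set_scope.
Local Open Scope ring_scope.

(* Nodes are 'I_(m + n): the first m (lshift) are the retailers and the last n
   (rshift) the consumers. *)
Record microgrid (R : realType) (m n : nat) := Microgrid {
  lineA : 'M[R]_(m + n);         (* line conductances, 1 / R_ij for i != j *)
  shunt : 'I_(m + n) -> R;       (* R_ii *)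
  tau_v : 'I_(m + n) -> R;
  gain : 'I_(m + n) -> R;        (* k_i *)
  tau_b : 'I_n -> R;
  Vstar : R;
  DeltaV : R;
  Pr_set : 'I_m -> R;            (* constant set-points of the retailers *)
  Pb_d : 'I_n -> R               (* constant demands of the consumers *)
}.

(* (all node voltages, set-points of the consumers); the norm and the topology
   are the library's ones on the product, i.e. those of the sup norm. *)
Notation state R m n := ('rV[R]_(m + n) * 'rV[R]_n)%type.

Section Microgrid.
Variables (R : realType) (m n : nat).
Implicit Types M : microgrid R m n.

Record wf_microgrid M : Prop := WfMicrogrid {
  lineA_sym : forall i j, lineA M i j = lineA M j i;
  lineA_diag : forall i, lineA M i i = 0;
  lineA_ge0 : forall i j, 0 <= lineA M i j;
  network_connected :
    forall i j, connect (fun a b : 'I_(m + n) => lineA M a b != 0) i j;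
  shunt_gt0 : forall i, 0 < shunt M i;
  tau_v_gt0 : forall i, 0 < tau_v M i;
  gain_gt0 : forall i, 0 < gain M i;
  tau_b_gt0 : forall b, 0 < tau_b M b;
  DeltaV_gt0 : 0 < DeltaV M
}.

Definition degree_mx M : 'M[R]_(m + n) :=
  diag_mx (\row_i \sum_j lineA M i j).

Definition laplacian M : 'M[R]_(m + n) := degree_mx M - lineA M.

Definition conductance M : 'M[R]_(m + n) :=
  laplacian M + invmx (diag_mx (\row_i shunt M i)).

(* 1 / R_ij, including the shunt term when j = i. *)
Definition inv_res M (i j : 'I_(m + n)) : R :=
  if j == i then (shunt M i)^-1 else lineA M i j.

Definition Pset M (x : state R m n) : 'rV[R]_(m + n) :=
  row_mx (\row_r Pr_set M r) x.2.

Definition voltage_rhs M (x : state R m n) (i : 'I_(m + n)) : R :=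
  let V := x.1 in
  (Vstar M - V 0 i
     - gain M i * (\sum_j conductance M i j * V 0 i * V 0 j)
     + gain M i * Pset M x 0 i)
  * (1 - (V 0 i - Vstar M) ^+ 2 / DeltaV M ^+ 2).

Definition setpoint_rhs M (x : state R m n) (b : 'I_n) : R := Pb_d M b - x.2 0 b.

(* Voltages are magnitudes, but no sign is imposed here; a stability result under
     k_i DeltaV \sum_j 1/R_ij < 1/2 + k_i V^*/R_ii
   needs the equilibrium voltages to be nonnegative.  With two nodes,
   k_i = tau_v,i = DeltaV = 1, V^* = 0, 1/R_12 = 45/100, R_ii = 100, that
   condition holds, but an equilibrium with voltages (-99/100, 99/100) (obtained
   by choosing the power inputs) is a saddle: up to a positive factor, the
   voltage block of the Jacobian is
     [0.3563, -0.4455; 0.4455, -2.3563], of negative determinant. *)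
Definition equilibrium M (x : state R m n) : Prop :=
  (forall i, voltage_rhs M x i = 0) /\ (forall b, setpoint_rhs M x b = 0).

(* Solutions on [0, +oo[.  Values at negative times are irrelevant; by
   continuity at 0 the equations also hold there for the right derivative. *)
Definition solution M (x : R -> state R m n) : Prop :=
  [/\ {within [set t : R | 0 <= t], continuous x},
      forall (t : R) (i : 'I_(m + n)), 0 < t ->
        derivable (fun s : R => (x s).1 0 i) t 1 /\
        tau_v M i * derive1 (fun s : R => (x s).1 0 i) t = voltage_rhs M (x t) i &
      forall (t : R) (b : 'I_n), 0 < t ->
        derivable (fun s : R => (x s).2 0 b) t 1 /\
        tau_b M b * derive1 (fun s : R => (x s).2 0 b) t = setpoint_rhs M (x t) b].

End Microgrid.

(* Main.v *)
Require Import Defs.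
From HB Require Import structures.
From mathcomp Require Import all_boot all_order all_algebra.
From mathcomp Require Import all_classical all_reals all_analysis.
From mathcomp Require Import ring lra.
Set Implicit Arguments.
Unset Strict Implicit.
Unset Printing Implicit Defensive.
Import Order.TTheory GRing.Theory Num.Theory.
Import numFieldNormedType.Exports.
Local Open Scope classical_set_scope.
Local Open Scope ring_scope.

(* Strict row diagonal dominance of the voltage block, read in the sup norm.
   With c_i = 1 + k_i (G Vbar)_i + k_i Vbar_i / R_ii, the stability condition
   and |Vbar_i - Vbar_j| < 2 DeltaV give c_i > 0, and if |V_i - Vbar_i| = N is
   the largest voltage deviation, then Vbar_i >= 0 makes the control error of
   node i push V_i back with strength at least N c_i, up to an error O(N eps).
   Hence, for eps and lam small, a solution that starts in the box
   |V_i - Vbar_i| < eps, |P_b - Pbar_b| < eps^2 never touches the boundary of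
   that box shrunk by exp(- lam t): at a first contact it would have to move
   outwards relative to the face it touches. *)

(** * First-contact arguments on the half-line *)

Lemma exists_lt_finite (R : realType) (I : finType) (a : I -> R) :
  (forall i, 0 < a i) -> exists2 e, 0 < e & forall i, e < a i.
Proof.
move=> a_gt0.
have near_lt : \forall e \near 0^'+, 0 < e /\ forall i, e < a i.
  near=> e; split; first by near: e; exact: nbhs_right_gt.
  near: e; apply: filter_forall => i; exact: nbhs_right_lt.
have [e [e0 ea]] := filter_ex near_lt.
by exists e.
Unshelve. all: by end_near. Qed.

Lemma derive_gt0_lt_left (R : realType) (f : R -> R) (t a : R) :
  a < t -> derivable f t 1 -> 0 < derive1 f t ->
  exists2 s, a < s < t & f s < f t.
Proof.
move=> at_ df f't.
have quo_gt0 : \forall h \near 0^', 0 < h^-1 *: (f (h *: 1 + t) - f t).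
  by apply: (cvgr_gt _ df); rewrite -[lim _]/('D_1 f t) -derive1E.
have [e /= e0 He] := quo_gt0.
(* A negative increment: halving both bounds keeps [h + t] strictly inside the neighbourhood and
   strictly to the right of [a]. *)
set h := - Num.min (e / 2) ((t - a) / 2).
have m0 : 0 < Num.min (e / 2) ((t - a) / 2).
  by rewrite lt_min !divr_gt0 ?subr_gt0.
have h0 : h < 0 by rewrite oppr_lt0.
have me : Num.min (e / 2) ((t - a) / 2) <= e / 2 by rewrite ge_min lexx.
have ma : Num.min (e / 2) ((t - a) / 2) <= (t - a) / 2 by rewrite ge_min lexx orbT.
exists (h + t); first by apply/andP; split; rewrite /h in h0 *; lra.
have : 0 < h^-1 *: (f (h *: 1 + t) - f t).
  apply: He => /=; last by rewrite lt_eqF.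
  by rewrite sub0r normrN ltr0_norm // /h opprK; lra.
by rewrite /GRing.scale /= mulr1 nmulr_rgt0 ?invr_lt0 // subr_lt0.
Qed.

(** Let [T] be the infimum of the times at which some [f j] is nonpositive. All [f j] are
    nonnegative at [T] and one of them vanishes there; its positive derivative would make it
    negative just before [T], where everything is still positive. *)
Lemma first_contact (R : realType) (I : finType) (f : I -> R -> R) :
  (forall i, {within [set t : R | 0 <= t], continuous (f i)}) ->
  (forall i (t : R), 0 < t -> derivable (f i) t 1) ->
  (forall i, 0 < f i 0) ->
  (forall i (t : R), 0 < t -> (forall j, 0 <= f j t) -> f i t = 0 ->
     0 < derive1 (f i) t) ->
  forall i (t : R), 0 <= t -> 0 < f i t.
Proof.
move=> fc fd f0 inward i t t0; rewrite ltNge; apply/negP => fit.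
pose S := [set s : R | 0 <= s /\ exists j, f j s <= 0].
have S0 : S !=set0 by exists t; split=> //; exists i.
have lbS : lbound S 0 by move=> s [].
have infS : has_inf S by split=> //; exists 0.
set T := inf S.
have T0 : 0 <= T by exact: lb_le_inf.
have ltT (s : R) j : 0 <= s -> s < T -> 0 < f j s.
  move=> s0 sT; rewrite ltNge; apply/negP => fs.
  have : T <= s by apply: ge_inf; [exists 0 | split=> //; exists j].
  by rewrite leNgt sT.
(* Otherwise continuity would keep the finitely many [f j] positive for a short time after [T],
   although [S] has points arbitrarily close to its infimum. *)
have not_pos : ~ forall j, 0 < f j T.
  move=> pos.
  have : \forall u \near within [set u | 0 <= u] (nbhs T), forall j, 0 < f j u.
    apply: filter_forall => j; have /subspace_continuousP := fc j.
    by move=> /(_ T T0) cj; exact: (@cvgr_gt R R _ _ (f j) _ cj 0 (pos j)).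
  move=> -[e /= e0 He].
  have [s [s0 [j fjs]] sTe] := inf_adherent e0 infS.
  have Ts : T <= s by apply: ge_inf; [exists 0 | split=> //; exists j].
  have := He s; rewrite /ball_ /= distrC ger0_norm ?subr_ge0 // ltrBlDl.
  by move=> /(_ sTe s0 j); rewrite ltNge fjs.
have Tgt0 : 0 < T.
  rewrite lt_neqAle T0 andbT; apply/eqP => T0'.
  by apply: not_pos => j; rewrite -T0'.
(* A negative value would persist slightly to the left of [T], where [ltT] gives positivity. *)
have fT_ge0 j : 0 <= f j T.
  rewrite leNgt; apply/negP => fjT.
  have cf : f j s @[s --> T] --> f j T.
    have df : differentiable (f j) T by apply/derivable1_diffP; exact: fd.
    exact: differentiable_continuous df.
  have := cvgr_lt _ cf _ fjT; move=> [e /= e0 He].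
  set d := Num.min (e / 2) (T / 2).
  have d0 : 0 < d by rewrite lt_min !divr_gt0.
  have de : d <= e / 2 by rewrite ge_min lexx.
  have dT : d <= T / 2 by rewrite ge_min lexx orbT.
  have := He (T - d); rewrite /ball_ /= opprB addrC subrK gtr0_norm //.
  have -> : d < e by lra.
  move=> /(_ isT); apply/negP; rewrite -leNgt ltW // ltT //; lra.
have /existsNP[j /negP] := not_pos; rewrite -leNgt => fj0.
have fj : f j T = 0 by apply/eqP; rewrite eq_le fj0 fT_ge0.
have [s /andP[s0 sT]] := derive_gt0_lt_left Tgt0 (fd j T Tgt0) (inward j T Tgt0 fT_ge0 fj).
by rewrite fj; apply/negP; rewrite -leNgt ltW // ltT // ltW.
Qed.

(** The shrinking box has two faces per coordinate. [first_contact] is applied to the distances to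
    all of them, indexed by [I * bool], the boolean giving the sign of the face. *)
Lemma exponential_trap (R : realType) (I : finType) (z : I -> R -> R)
    (r : I -> R) (lam : R) :
  (forall i, {within [set t : R | 0 <= t], continuous (z i)}) ->
  (forall i (t : R), 0 < t -> derivable (z i) t 1) ->
  (forall i, `|z i 0| < r i) ->
  (forall i (b : bool) (t : R), 0 < t ->
     (forall j, `|z j t| <= r j * expR (- lam * t)) ->
     (-1) ^+ b * z i t = r i * expR (- lam * t) ->
     (-1) ^+ b * derive1 (z i) t < - lam * (r i * expR (- lam * t))) ->
  forall i (t : R), 0 <= t -> `|z i t| < r i * expR (- lam * t).
Proof.
move=> zc zd z0 inward i t t0.
pose f (p : I * bool) (s : R) := r p.1 * expR (- lam * s) - (-1) ^+ p.2 * z p.1 s.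
have expd (s : R) : is_derive s 1 (fun s : R => expR (- lam * s)) (- lam * expR (- lam * s)).
  have dl : is_derive s 1 ( *%R (- lam)) (- lam).
    exact: is_derive_eq (is_deriveZ (- lam) (is_derive_id s 1)) (mulr1 _).
  by rewrite mulrC; exact: is_derive1_comp (is_derive_expR _) dl.
have fd p (s : R) : 0 < s -> is_derive s 1 (f p)
    (r p.1 * (- lam * expR (- lam * s)) - (-1) ^+ p.2 * derive1 (z p.1) s).
  move=> s0; have zds := derivableP (zd p.1 s s0); rewrite derive1E.
  exact: (is_deriveB (is_deriveZ (r p.1) (expd s))
                     (is_deriveZ ((-1) ^+ p.2) zds)).
have pos : forall p (s : R), 0 <= s -> 0 < f p s.
  apply: first_contact.
  - move=> p u; apply: cvgB; apply: cvgMr; last exact: zc.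
    have cexp : continuous (fun s : R => expR (- lam * s)).
      move=> s; apply: differentiable_continuous; apply/derivable1_diffP.
      by case: (expd s).
    exact: (continuous_subspaceT cexp).
  - by move=> p s s0; case: (fd p s s0).
  - move=> [j b]; rewrite /f /= mulr0 expR0 mulr1 subr_gt0.
    by rewrite (le_lt_trans _ (z0 j)) // (le_trans (ler_norm _)) // normrM normr_sign mul1r.
  - move=> [j b] s s0 fge0 /eqP; rewrite /f /= subr_eq0 => /eqP fj.
    rewrite derive1E; have [_ ->] := fd (j, b) s s0; rewrite /= subr_gt0.
    have -> : r j * (- lam * expR (- lam * s)) = - lam * (r j * expR (- lam * s)) by ring.
    apply: inward => // k; rewrite ler_norml.
    have := fge0 (k, true); have := fge0 (k, false); rewrite /f /= expr0 expr1.
    by move=> ? ?; apply/andP; split; lra.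
have := pos (i, true) t t0; have := pos (i, false) t t0; rewrite /f /= expr0 expr1.
by move=> ? ?; rewrite ltr_norml; apply/andP; split; lra.
Qed.

(** * Kirchhoff currents and diagonal dominance *)

Section Network.
Variables (R : realType) (m n : nat) (M : microgrid R m n).
Implicit Types (x : state R m n) (V : 'rV[R]_(m + n)) (i : 'I_(m + n)).

(** Entry [i] of G V. Writing the Laplacian part with voltage differences makes signs visible at a
    node of maximal deviation. *)
Definition current V i : R :=
  V 0 i / shunt M i + \sum_j lineA M i j * (V 0 i - V 0 j).

Definition row_conductance i : R := \sum_j lineA M i j.

Definition control_error x i : R :=
  Vstar M - x.1 0 i - gain M i * (x.1 0 i * current x.1 i) + gain M i * Pset M x 0 i.

(** Minus the sum of row [i] of the voltage Jacobian of [control_error]. Where V_i >= 0 the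
    off-diagonal entries k_i V_i A_ij are nonnegative, so this is the diagonal dominance gap of the
    row. *)
Definition margin V i : R :=
  1 + gain M i * current V i + gain M i * (V 0 i / shunt M i).

Hypothesis wfM : wf_microgrid M.

Lemma row_conductance_ge0 i : 0 <= row_conductance i.
Proof. by apply: sumr_ge0 => j _; apply: lineA_ge0. Qed.

Lemma invmx_shunt :
  invmx (diag_mx (\row_i shunt M i)) = diag_mx (\row_i (shunt M i)^-1).
Proof.
have prod1 : diag_mx (\row_i (shunt M i)^-1) *m diag_mx (\row_i shunt M i) = 1%:M.
  rewrite mul_diag_mx; apply/matrixP => i j; rewrite !mxE.
  case: eqP => _; last by rewrite mulr0.
  by rewrite mulVf // gt_eqF // shunt_gt0.
by rewrite -[LHS]mul1mx -prod1 mulmxK // (mulmx1_unit prod1).2.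
Qed.

Lemma conductance_sum V i :
  \sum_j conductance M i j * V 0 i * V 0 j = V 0 i * current V i.
Proof.
rewrite /conductance invmx_shunt /laplacian /degree_mx /current.
under eq_bigr do rewrite !mxE.
rewrite (eq_bigr (fun j => V 0 i *
  ((if j == i then (row_conductance i + (shunt M i)^-1) * V 0 j else 0)
   - lineA M i j * V 0 j))); last first.
  move=> j _; rewrite eq_sym /row_conductance.
  by case: eqP => [->|_]; rewrite ?mulr1n ?mulr0n; ring.
rewrite -big_distrr /= sumrB -big_mkcond /= big_pred1_eq; congr (_ * _).
under [in RHS]eq_bigr do rewrite mulrBr.
by rewrite sumrB -big_distrl /= -/(row_conductance i); ring.
Qed.

Lemma voltage_rhsE x i : voltage_rhs M x i =
  control_error x i * (1 - (x.1 0 i - Vstar M) ^+ 2 / DeltaV M ^+ 2).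
Proof. by rewrite /voltage_rhs conductance_sum. Qed.

Lemma inv_res_sum i : \sum_j inv_res M i j = (shunt M i)^-1 + row_conductance i.
Proof.
rewrite (bigD1 i) //= /row_conductance [in RHS](bigD1 i) //= lineA_diag // add0r.
rewrite /inv_res eqxx; congr (_ + _); apply: eq_bigr => j /negPf ji.
by rewrite ji.
Qed.

(** Two voltages differ by less than 2 DeltaV, which bounds the line currents from below; V_i > V^*
    - DeltaV bounds the two shunt terms. Together the margin exceeds twice the slack in the
    stability condition, whence the constant 1/2 there. *)
Lemma margin_gt0 V i :
  (forall j, `|V 0 j - Vstar M| < DeltaV M) ->
  gain M i * DeltaV M * (\sum_j inv_res M i j)
    < 2^-1 + gain M i * (Vstar M / shunt M i) ->
  0 < margin V i.
Proof.
move=> Vnear; rewrite inv_res_sum => stab.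
have k0 := gain_gt0 wfM i; have g0 := shunt_gt0 wfM i; rewrite -invr_gt0 in g0.
have cur : V 0 i / shunt M i - 2 * DeltaV M * row_conductance i <= current V i.
  rewrite /current lerD2l mulr_sumr -sumrN; apply: ler_sum => j _.
  have -> : - (2 * DeltaV M * lineA M i j) = lineA M i j * - (2 * DeltaV M) by ring.
  apply: ler_wpM2l; first exact: lineA_ge0.
  by have := Vnear i; have := Vnear j; rewrite !ltr_norml => /andP[? ?] /andP[? ?]; lra.
have := ler_wpM2l (ltW k0) cur; rewrite /margin => kcur.
have : 0 < gain M i / shunt M i * (DeltaV M - Vstar M + V 0 i).
  rewrite mulr_gt0 ?mulr_gt0 //; have := Vnear i; rewrite ltr_norml => /andP[? ?]; lra.
move: stab kcur; set g := (shunt M i)^-1; set k := gain M i; set D := DeltaV M.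
set S := row_conductance i; set C := current V i; lra.
Qed.

(* [(-1) ^+ b] is the sign of the deviation at [i], which is maximal; the
   set-points may only deviate at second order, whence [eps * N]. *)
Lemma control_error_inward (x y : state R m n) i (b : bool) (N eps : R) :
  0 <= N <= eps -> 0 <= x.1 0 i ->
  (forall j, `|y.1 0 j - x.1 0 j| <= N) ->
  `|Pset M y 0 i - Pset M x 0 i| <= eps * N ->
  (-1) ^+ b * (y.1 0 i - x.1 0 i) = N ->
  (-1) ^+ b * (control_error y i - control_error x i) <=
    - N * (margin x.1 i - eps * (gain M i * ((shunt M i)^-1 + 2 * row_conductance i + 1))).
Proof.
move=> /andP[N0 Neps] x0 yx pyx yxi.
have k0 := gain_gt0 wfM i; have g0 := shunt_gt0 wfM i; rewrite -invr_gt0 in g0.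
set s := (-1) ^+ b in yxi *.
have sabs a : s * a <= `|a| by rewrite (le_trans (ler_norm _)) // normrM normr_sign mul1r.
have s2 : s * s = 1 by rewrite /s -signr_addb addbb.
(* Signed change of the current. As the deviation at [i] is maximal, each difference of deviations
   in [qE] lies in [0, 2 N], which gives [q_ge] and [q_le]. *)
set q := s * (current y.1 i - current x.1 i).
have qE : q = N / shunt M i + \sum_j lineA M i j * (N - s * (y.1 0 j - x.1 0 j)).
  rewrite /q /current -yxi.
  have -> : \sum_j lineA M i j * (s * (y.1 0 i - x.1 0 i) - s * (y.1 0 j - x.1 0 j)) =
    s * (\sum_j lineA M i j * (y.1 0 i - y.1 0 j) - \sum_j lineA M i j * (x.1 0 i - x.1 0 j)).
    by rewrite -sumrB mulr_sumr; apply: eq_bigr => j _; ring.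
  ring.
have q_ge : N / shunt M i <= q.
  rewrite qE lerDl; apply: sumr_ge0 => j _; apply: mulr_ge0; first exact: lineA_ge0.
  by rewrite subr_ge0 (le_trans (sabs _)).
have q_le : q <= N * ((shunt M i)^-1 + 2 * row_conductance i).
  rewrite qE mulrDr lerD2l mulrA mulr_sumr; apply: ler_sum => j _.
  rewrite mulrC; apply: ler_wpM2r; first exact: lineA_ge0.
  have := yx j; have := sabs (- (y.1 0 j - x.1 0 j)); rewrite normrN; lra.
have y_ge : x.1 0 i - eps <= y.1 0 i.
  by have := yx i; rewrite ler_norml => /andP[? ?]; lra.
have q0 : 0 <= q by apply: le_trans q_ge; rewrite mulr_ge0 // ltW.
(* The lower bound on [q] is used with the factor [x.1 0 i], which is nonnegative, and the upper
   bound with [- eps]; the loss is of order [eps * N]. *)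
have yq : x.1 0 i * (N / shunt M i) - eps * (N * ((shunt M i)^-1 + 2 * row_conductance i))
    <= y.1 0 i * q.
  apply: le_trans (ler_wpM2r q0 y_ge); rewrite mulrBl lerB //.
    exact: ler_wpM2l.
  by apply: ler_wpM2l => //; exact: le_trans Neps.
have sp : s * (Pset M y 0 i - Pset M x 0 i) <= eps * N by exact: le_trans (sabs _) pyx.
have := ler_wpM2l (ltW k0) sp; have := ler_wpM2l (ltW k0) yq.
have -> : s * (control_error y i - control_error x i) =
   - N - gain M i * (y.1 0 i * q + N * current x.1 i)
   + gain M i * (s * (Pset M y 0 i - Pset M x 0 i)).
  by rewrite /control_error /q -yxi; ring.
rewrite /margin; lra.
Qed.

Lemma Pset_dist_le (x y : state R m n) i (d : R) : 0 <= d ->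
  (forall b, `|y.2 0 b - x.2 0 b| <= d) -> `|Pset M y 0 i - Pset M x 0 i| <= d.
Proof.
move=> d0 yx; rewrite /Pset; have [j ->|j ->] := split_ordP i.
  by rewrite !row_mxEl subrr normr0.
by rewrite !row_mxEr.
Qed.

End Network.

(** * The sup norm of a state, by coordinates *)

Lemma state_norm_le (R : realType) (m n : nat) (x : state R m n) (d : R) : 0 <= d ->
  (forall i, `|x.1 0 i| <= d) -> (forall b, `|x.2 0 b| <= d) -> `|x| <= d.
Proof.
have mx_le k (v : 'rV[R]_k) : 0 <= d -> (forall i, `|v 0 i| <= d) -> `|v| <= d.
  move=> d0 vd; rewrite /Num.norm /= mx_normrE; apply: bigmax_le => // -[i j] _ /=.
  by rewrite ord1.
by move=> d0 x1 x2; rewrite prod_normE ge_max !mx_le.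
Qed.

Lemma state_coord_le (R : realType) (m n : nat) (x : state R m n) :
  (forall i, `|x.1 0 i| <= `|x|) /\ (forall b, `|x.2 0 b| <= `|x|).
Proof.
have mx_le k (v : 'rV[R]_k) i : `|v 0 i| <= `|v|.
  rewrite [leRHS]/Num.norm /= mx_normrE.
  exact: (le_bigmax _ (fun ij : 'I_1 * 'I_k => `|v ij.1 ij.2|) (0, i)).
by rewrite prod_normE; split=> i; rewrite le_max mx_le ?orbT.
Qed.

Theorem proposition2 (R : realType) (m n : nat) (M : microgrid R m n)
    (xbar : state R m n)
    (wfM : wf_microgrid M)
    (eq_xbar : equilibrium M xbar)
    (Vbar_near : forall i, `|xbar.1 0 i - Vstar M| < DeltaV M)
    (Vbar_ge0 : forall i, 0 <= xbar.1 0 i)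
    (stab : forall i,
       gain M i * DeltaV M * (\sum_j inv_res M i j)
         < 2^-1 + gain M i * (Vstar M / shunt M i)) :
  exists A : set (state R m n),
    nbhs xbar A /\
    forall x : R -> state R m n,
      solution M x -> A (x 0) ->
      `|x t - xbar| @[t --> +oo] --> 0.
Proof.
have D0 := DeltaV_gt0 wfM; have [eqV eqPb] := eq_xbar.
(* Half the distance from the equilibrium voltage to the nearer saturation bound: a deviation of at
   most [eps < gap i] keeps the saturation factor above [h i > 0]. *)
pose gap i := (DeltaV M - `|xbar.1 0 i - Vstar M|) / 2.
have gap0 i : 0 < gap i by rewrite divr_gt0 // subr_gt0.
pose c i := margin M xbar.1 i.
have c0 i : 0 < c i by exact: margin_gt0.
(* The coefficient of [eps] in [control_error_inward]; the choice of [eps] below lets it consume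
   less than half of the margin [c i]. *)
pose load i := gain M i * ((shunt M i)^-1 + 2 * row_conductance M i + 1).
have load0 i : 0 < load i.
  rewrite mulr_gt0 ?gain_gt0 // ltr_wpDl // addr_ge0 ?invr_ge0 ?(ltW (shunt_gt0 _ _)) //.
  by rewrite mulr_ge0 ?row_conductance_ge0.
have [eps eps0 eps_lt] : exists2 e, 0 < e & forall i, e < Num.min (gap i) (c i / 2 / load i).
  by apply: exists_lt_finite => i; rewrite lt_min gap0 !divr_gt0.
have eps_gap i : eps < gap i by have := eps_lt i; rewrite lt_min => /andP[].
have eps_load i : eps * load i < c i / 2.
  by rewrite -ltr_pdivlMr //; have := eps_lt i; rewrite lt_min => /andP[].
pose sat (V : R) : R := 1 - (V - Vstar M) ^+ 2 / DeltaV M ^+ 2.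
pose h i := 1 - (DeltaV M - gap i) ^+ 2 / DeltaV M ^+ 2.
have gapD i : 0 < DeltaV M - gap i < DeltaV M.
  by rewrite gtrBl gap0 andbT /gap; have := normr_ge0 (xbar.1 0 i - Vstar M); lra.
have h0 i : 0 < h i.
  have /andP[? ?] := gapD i.
  rewrite subr_gt0 ltr_pdivrMr ?exprn_gt0 // mul1r ltrXn2r ?nnegrE //; lra.
have sat_ge (V : R) i : `|V - xbar.1 0 i| <= eps -> h i <= sat V.
  move=> Veps; rewrite lerD2l lerN2 ler_pM2r ?invr_gt0 ?exprn_gt0 //.
  rewrite -[leLHS]real_normK ?num_real // lerXn2r ?nnegrE //.
    by have /andP[/ltW] := gapD i.
  have := ler_normD (V - xbar.1 0 i) (xbar.1 0 i - Vstar M); rewrite addrA subrK.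
  by have := eps_gap i; rewrite /gap; lra.
(* The saturation factor is positive at the equilibrium, so the other factor must vanish. *)
have err0 i : control_error M xbar i = 0.
  have /eqP := eqV i; rewrite voltage_rhsE // mulf_eq0 => /orP[/eqP //|/eqP s0].
  have := sat_ge (xbar.1 0 i) i; rewrite subrr normr0 => /(_ (ltW eps0)).
  by rewrite /sat s0 leNgt h0.
(* Guaranteed inward speeds relative to the radius: half the margin times the least saturation
   factor for voltages, exact linear relaxation for set-points. *)
pose rate (j : 'I_(m + n) + 'I_n) :=
  match j with inl i => c i / 2 * h i / tau_v M i | inr b => (tau_b M b)^-1 end.
have [lam lam0 lam_lt] : exists2 l, 0 < l & forall j, l < rate j.
  apply: exists_lt_finite => -[i|b] /=; last by rewrite invr_gt0 tau_b_gt0.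
  by rewrite divr_gt0 ?tau_v_gt0 ?mulr_gt0.
pose r (j : 'I_(m + n) + 'I_n) : R := if j is inl _ then eps else eps ^+ 2.
pose d := Num.min eps (eps ^+ 2).
have d0 : 0 < d by rewrite lt_min eps0 exprn_gt0.
exists (ball xbar d); split; first exact: nbhsx_ballx.
move=> x [xc xV xP]; rewrite -ball_normE /ball_ /= distrC => xd.
pose z (j : 'I_(m + n) + 'I_n) (t : R) : R :=
  match j with inl i => (x t).1 0 i - xbar.1 0 i
         | inr b => (x t).2 0 b - xbar.2 0 b end.
have zE j (t : R) : 0 < t -> derivable (z j) t 1 /\
   derive1 (z j) t = match j with inl i => derive1 (fun s => (x s).1 0 i) t
                                | inr b => derive1 (fun s => (x s).2 0 b) t end.
  case: j => [i|b] t0.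
    have [dx _] := xV t i t0; rewrite !derive1E.
    have := is_deriveB (derivableP dx) (is_derive_cst (xbar.1 0 i) t 1).
    by rewrite subr0 => -[].
  have [dx _] := xP t b t0; rewrite !derive1E.
  have := is_deriveB (derivableP dx) (is_derive_cst (xbar.2 0 b) t 1).
  by rewrite subr0 => -[].
have trap : forall j (t : R), 0 <= t -> `|z j t| < r j * expR (- lam * t).
  apply: exponential_trap.
  - case=> [i|b] u; apply: cvgB; try exact: cvg_cst.
      apply: (@cvg_comp _ _ _ (fst \o x) (fun V : 'rV[R]_(m + n) => V 0 i));
        last exact: coord_continuous.
      by apply: cvg_comp (xc u) _; exact: cvg_fst.
    apply: (@cvg_comp _ _ _ (snd \o x) (fun V : 'rV[R]_n => V 0 b));
      last exact: coord_continuous.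
    by apply: cvg_comp (xc u) _; exact: cvg_snd.
  - by move=> j t t0; case: (zE j t t0).
  - have [x1 x2] := state_coord_le (x 0 - xbar).
    have xd_lt j : `|x 0 - xbar| < r j.
      by apply: lt_le_trans xd _; case: j => k; rewrite ge_min lexx ?orbT.
    case=> [i|b].
      by have := x1 i; rewrite !mxE => /le_lt_trans; apply; exact: (xd_lt (inl i)).
    by have := x2 b; rewrite !mxE => /le_lt_trans; apply; exact: (xd_lt (inr b)).
  move=> j b t t0 inside; set E := expR (- lam * t); rewrite (zE j t t0).2.
  have E0 : 0 < E by exact: expR_gt0.
  have E1 : E <= 1 by rewrite -expR0 ler_expR mulNr oppr_le0 mulr_ge0 // ltW.
  have lamj := lam_lt j; case: j lamj => [i|p] /= lamj zj.
    (* Contact on a voltage face: the largest deviation is N = [eps * E], and the set-point radius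
       [eps ^+ 2 * E] is exactly [eps * N]. *)
    have N_le : eps * E <= eps by rewrite ger_pMr.
    have err := @control_error_inward _ _ _ _ wfM xbar (x t) i b (eps * E) eps.
    have {err} : (-1) ^+ b * control_error M (x t) i <= - (eps * E) * (c i - eps * load i).
      rewrite -[control_error _ _ _]subr0 -(err0 i); apply: err => //.
      - by rewrite N_le andbT mulr_ge0 // ltW.
      - by move=> j; exact: (inside (inl j)).
      - apply: Pset_dist_le; first by rewrite !mulr_ge0 // ltW.
        by move=> p; rewrite mulrA; exact: (inside (inr p)).
    have := sat_ge ((x t).1 0 i) i (le_trans (inside (inl i)) N_le).
    have [_] := xV t i t0; rewrite voltage_rhsE // -/(sat _).
    move=> tauV sat_h err; rewrite -(ltr_pM2l (tau_v_gt0 wfM i)) mulrCA tauV mulrA.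
    have {err} err : (-1) ^+ b * control_error M (x t) i <= - (eps * E * (c i / 2)).
      apply: le_trans err _; rewrite mulNr lerN2 ler_pM2l ?mulr_gt0 //.
      by have := eps_load i; lra.
    have epsEc : 0 < eps * E * (c i / 2) by rewrite !mulr_gt0 ?divr_gt0.
    (* The bound on the error is negative, so the lower bound [h i] of the saturation factor gives
       the weakest inward push, which still beats [lam]. *)
    apply: le_lt_trans (ler_wpM2r (le_trans (ltW (h0 i)) sat_h) err) _.
    rewrite !mulNr mulrN ltrN2.
    apply: lt_le_trans (ler_wpM2l (ltW epsEc) sat_h).
    move: lamj; rewrite ltr_pdivlMr ?tau_v_gt0 // => lamj.
    have -> : tau_v M i * (lam * (eps * E)) = eps * E * (lam * tau_v M i) by ring.
    by rewrite -[ltRHS]mulrA ltr_pM2l ?mulr_gt0.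
  have [_] := xP t p t0; have := eqPb p; rewrite /setpoint_rhs => P0 tauP.
  rewrite -(ltr_pM2l (tau_b_gt0 wfM p)) mulrCA tauP.
  have -> : Pb_d M p - (x t).2 0 p = - ((x t).2 0 p - xbar.2 0 p) by lra.
  rewrite mulrN zj mulNr mulrN ltrN2 mulrA gtr_pMl ?mulr_gt0 ?exprn_gt0 //.
  by rewrite mulrC -ltr_pdivlMr ?tau_b_gt0 // mul1r.
(* The maximum covers both radii, since [eps] may exceed 1. *)
apply: (@squeeze_cvgr _ _ _ _ (cst 0) (fun t => Num.max eps (eps ^+ 2) * expR (- (lam * t)))).
- near=> t; rewrite normr_ge0 /=; have t0 : 0 <= t by near: t; exact: nbhs_pinfty_ge.
  have E0 := expR_gt0 (- lam * t).
  rewrite -mulNr; apply: state_norm_le.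
  + by rewrite mulr_ge0 ?ltW // lt_max eps0.
  + move=> i; rewrite !mxE; apply: le_trans (ltW (trap (inl i) t t0)) _.
    by rewrite ler_pM2r // le_max lexx.
  + move=> i; rewrite !mxE; apply: le_trans (ltW (trap (inr i) t t0)) _.
    by rewrite ler_pM2r // le_max lexx orbT.
- exact: cvg_cst.
- rewrite -[X in _ --> X](mulr0 (Num.max eps (eps ^+ 2))); apply: cvgMr.
  apply: (@cvg_comp _ _ _ ( *%R lam) (fun u => expR (- u)) _ +oo%R); last exact: cvgr_expR.
  exact: gt0_cvgMry.
Unshelve. all: by end_near. Qed.
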